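(* Let $M$ be a Riemannian manifold and let $f:M\to\mathbb{R}$ be differentiable, geodesically $L$-smooth and geodesically $\mu$-strongly convex ($L>0$, $0\le\mu\le L$) with minimizer $x_*$. Let $\gamma_{t+1}\in(0,2/L)$, $\Delta_\gamma:=\gamma_{t+1}(1-L\gamma_{t+1}/2)$, and let $x_t,y_t,z_t\in M$, $A_t,B_t>0$ and $\delta_{t+1}>0$ be given. Let $\xi_{t+1}\in[2\mu\Delta_\gamma,1)$ satisfy $$\frac{\xi_{t+1}(\xi_{t+1}-2\mu\Delta_\gamma)}{1-\xi_{t+1}}=\frac{4\Delta_\gamma}{\delta_{t+1}}\cdot\frac{B_t}{A_t},$$ and set $$A_{t+1}=\frac{A_t}{1-\xi_{t+1}},\quad B_{t+1}=\frac{\xi_{t+1}^2}{1-\xi_{t+1}}\cdot\frac{A_t}{4\Delta_\gamma},\quad \alpha_{t+1}=\frac{\xi_{t+1}-2\mu\Delta_\gamma}{1-2\mu\Delta_\gamma},\quad \beta_{t+1}=1-2\mu\Delta_\gamma\xi_{t+1}^{-1},\quad \eta_{t+1}=2\Delta_\gamma\xi_{t+1}^{-1}.$$ Define $$x_{t+1}=\mathrm{Exp}_{y_t}\big(\alpha_{t+1}\mathrm{Exp}_{y_t}^{-1}(z_t)\big),\quad y_{t+1}=\mathrm{Exp}_{x_{t+1}}\big(-\gamma_{t+1}\nabla f(x_{t+1})\big),\quad z_{t+1}=\mathrm{Exp}_{x_{t+1}}\big(\beta_{t+1}\mathrm{Exp}_{x_{t+1}}^{-1}(z_t)-\eta_{t+1}\nabla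 f(x_{t+1})\big).$$ Assume that $\delta_{t+1}$ is a valid distortion rate at iteration $t+1$, i.e. $d_{x_{t+1}}(z_t,x_* )^2\le\delta_{t+1}\,d_{x_t}(z_t,x_* )^2$. Then $\Psi_{t+1}\le\Psi_t$, where $\Psi_s:=A_s(f(y_s)-f(x_* ))+B_s\,d_{x_s}(z_s,x_* )^2$ for $s\in\{t,t+1\}$. In other words, $$f(y_{t+1})-f(x_* )+\frac{\xi_{t+1}^2}{4\Delta_\gamma}d_{x_{t+1}}(z_{t+1},x_* )^2\le(1-\xi_{t+1})\Big[f(y_t)-f(x_* )+\frac{B_t}{A_t}d_{x_t}(z_t,x_* )^2\Big].$$
   Context: Standing assumptions: the sectional curvatures of $M$ are bounded below by $-\kappa$ for some $\kappa\ge0$; any two points of $M$ are connected by a unique geodesic, and the exponential map $\mathrm{Exp}_x:T_xM\to M$ has a well-defined inverse $\mathrm{Exp}_x^{-1}:M\to T_xM$ for each $x$. $d$ is the Riemannian distance and $\nabla f$ the Riemannian gradient. The projected distance of $v,w\in M$ relative to $u\in M$ is $d_u(v,w):=\|\mathrm{Exp}_u^{-1}(v)-\mathrm{Exp}_u^{-1}(w)\|$ (norm of $T_uM$). $f$ is geodesically $\mu$-strongly convex if $f(y)\ge f(x)+\langle\nabla f(x),\mathrm{Exp}_x^{-1}(y)\rangle_x+\frac{\mu}{2}d(x,y)^2$ for all $x,y\in M$, and geodesically $L$-smooth if $f(y)\le f(x)+\langle\nabla f(x),\mathrm{Exp}_x^{-1}(y)\rangle_x+\frac{L}{2}d(x,y)^2$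 for all $x,y\in M$. *)

(* Defs.v *)
From HB Require Import structures.
From mathcomp Require Import all_boot all_order all_algebra.
From mathcomp Require Import all_classical all_reals all_analysis.

Set Implicit Arguments.
Unset Strict Implicit.
Unset Printing Implicit Defensive.

Import Order.TTheory GRing.Theory Num.Theory.
Import numFieldNormedType.Exports.

Local Open Scope classical_set_scope.
Local Open Scope ring_scope.

(* [Ck k U f] is only meant for [U] open. *)
Fixpoint Ck (R : realType) (V W : normedModType R) (k : nat) (U : set V)
    (f : V -> W) {struct k} : Prop :=
  match k with
  | 0%N => forall u, U u -> {for u, continuous f}
  | k'.+1 => (forall u, U u -> differentiable f u) /\
             (forall v : V, Ck k' U ('D_v f))
  end.

Definition smooth_on (R : realType) (V W : normedModType R) (U : set V)
    (f : V -> W) : Prop := forall k, Ck k U f.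

(* Charts are total functions; [chart_map i] and [chart_inv i] are junk outside
   [chart_dom i] and its image. *)
Record smoothManifold (R : realType) (n : nat) := SmoothManifold {
  carrier :> topologicalType;
  carrier_hausdorff : hausdorff_space carrier;
  carrier_second_countable : @second_countable carrier;
  chart_index : Type;
  chart_dom : chart_index -> set carrier;
  chart_map : chart_index -> carrier -> 'rV[R]_n;
  chart_inv : chart_index -> 'rV[R]_n -> carrier;
  chart_at : carrier -> chart_index;
  chart_at_dom : forall p, chart_dom (chart_at p) p;
  chart_dom_open : forall i, open (chart_dom i);
  chart_image_open : forall i, open (chart_map i @` chart_dom i);
  chart_mapK : forall i p, chart_dom i p -> chart_inv i (chart_map i p) = p;
  chart_map_continuous : forall i p, chart_dom i p ->
    {for p, continuous (chart_map i)};
  chart_inv_continuous : forall i u, (chart_map i @` chart_dom i) u ->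
    {for u, continuous (chart_inv i)};
  transition_smooth : forall i j,
    smooth_on (chart_map i @` (chart_dom i `&` chart_dom j))
              (chart_map j \o chart_inv i)
}.

(* The tangent space at [p] is the space 'rV[R]_n of coordinate vectors with
   respect to the preferred chart [chart_at p].  Hence a row vector is
   meaningful as a tangent vector only together with its base point. *)

Definition bilin (R : realType) (n : nat) (G : 'M[R]_n) (v w : 'rV[R]_n) : R :=
  (v *m G *m w^T) 0 0.

(* Gram matrix, in the coordinates of chart [i], of a field [g] of bilinear
   forms on the tangent spaces.  The Jacobian J is that of the change from
   chart [i] to the preferred chart; since 'J acts on row vectors from the
   right, the pullback is J g J^T. *)
Definition gram (R : realType) (n : nat) (M : smoothManifold R n)
    (g : M -> 'M[R]_n) (i : chart_index M) (u : 'rV[R]_n) : 'M[R]_n :=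
  let p := chart_inv i u in
  let J := 'J (chart_map (chart_at p) \o chart_inv i) u in
  J *m g p *m J^T.

Record riemannianManifold (R : realType) (n : nat) := RiemannianManifold {
  underlying :> smoothManifold R n;
  metric : underlying -> 'M[R]_n;
  metric_sym : forall p, (metric p)^T = metric p;
  metric_pos : forall p v, v != 0 -> 0 < bilin (metric p) v v;
  metric_smooth : forall (i : chart_index underlying) (a b : 'I_n),
    smooth_on (chart_map i @` chart_dom i)
      (fun u : 'rV[R]_n => (gram metric i u a b : R^o))
}.

Section Riemannian.
Variables (R : realType) (n : nat) (M : riemannianManifold R n).

Implicit Types (p x y : M) (c : R -> M) (i : chart_index M).

Definition inner p (v w : 'rV[R]_n) : R := bilin (metric p) v w.

Definition tnorm p (v : 'rV[R]_n) : R := Num.sqrt (inner p v v).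

(* Partial derivative in the [a]-th coordinate. *)
Definition pderiv (a : 'I_n) (h : 'rV[R]_n -> R) (u : 'rV[R]_n) : R :=
  'D_(delta_mx 0 a) (h : 'rV[R]_n -> R^o) u.

(* Christoffel symbol Gamma^k_{ab} of the Levi-Civita connection. *)
Definition christoffel i (k a b : 'I_n) (u : 'rV[R]_n) : R :=
  2^-1 * \sum_(l < n) invmx (gram (@metric _ _ M) i u) k l *
    (pderiv a (fun w => gram (@metric _ _ M) i w l b) u
     + pderiv b (fun w => gram (@metric _ _ M) i w l a) u
     - pderiv l (fun w => gram (@metric _ _ M) i w a b) u).

(* Component l of R(d_a, d_b) d_c, with the convention
   R(X,Y)Z = nabla_X nabla_Y Z - nabla_Y nabla_X Z - nabla_[X,Y] Z. *)
Definition riemann i (l a b c : 'I_n) (u : 'rV[R]_n) : R :=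
  pderiv a (christoffel i l b c) u - pderiv b (christoffel i l a c) u
  + \sum_(m < n) (christoffel i l a m u * christoffel i m b c u
                  - christoffel i l b m u * christoffel i m a c u).

Definition curvature p (v w z : 'rV[R]_n) : 'rV[R]_n :=
  \row_(l < n) \sum_(a < n) \sum_(b < n) \sum_(c < n)
    v 0 a * w 0 b * z 0 c *
    riemann (chart_at p) l a b c (chart_map (chart_at p) p).

Definition sectional p (v w : 'rV[R]_n) : R :=
  inner p (curvature p v w w) v /
  (inner p v v * inner p w w - inner p v w ^+ 2).

Definition sectional_bounded_below (k : R) : Prop :=
  forall p (v w : 'rV[R]_n), row_free (col_mx v w) -> k <= sectional p v w.

(* Tangent vector at [c t], in the preferred chart at [c t]. *)
Definition velocity c (t : R) : 'rV[R]_n :=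
  derive1 (chart_map (chart_at (c t)) \o c) t.

Definition C1_at c (t : R) : Prop :=
  {for t, continuous c} /\
  forall i, chart_dom i (c t) ->
    (\forall s \near t, derivable (chart_map i \o c) s 1) /\
    {for t, continuous (derive1 (chart_map i \o c))}.

(* The geodesic equation nabla_{c'} c' = 0 at time [t]. *)
Definition geodesic_at c (t : R) : Prop :=
  {for t, continuous c} /\
  forall i, chart_dom i (c t) ->
    let u := chart_map i \o c in
    [/\ \forall s \near t, derivable u s 1,
        derivable (derive1 u) t 1 &
        forall k : 'I_n,
          derive1 (derive1 u) t 0 k + \sum_(a < n) \sum_(b < n)
            christoffel i k a b (u t) * derive1 u t 0 a * derive1 u t 0 b = 0].

(* Curves and geodesics parametrized by [0, 1] are functions on R of which only
   the restriction to a neighbourhood of [0, 1] is relevant; this avoids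
   one-sided derivatives at the endpoints. *)
Definition on_unit_interval (P : R -> Prop) : Prop :=
  exists2 e : R, 0 < e & forall t, - e < t -> t < 1 + e -> P t.

Definition C1_curve c : Prop := on_unit_interval (C1_at c).

Definition geodesic c : Prop := on_unit_interval (geodesic_at c).

Definition joins c x y : Prop := c 0 = x /\ c 1 = y.

Definition curve_length c : R :=
  Rintegral lebesgue_measure `[0, 1] (fun t => tnorm (c t) (velocity c t)).

Definition rdist x y : R :=
  inf [set l | exists c, [/\ C1_curve c, joins c x y & l = curve_length c]].

(* Uniqueness is among all geodesics.  That the geodesic from x to y realizes
   the distance is what Hopf-Rinow gives on a complete manifold. *)
Definition uniquely_geodesic : Prop :=
  forall x y, exists c,
    [/\ geodesic c, joins c x y, curve_length c = rdist x y &
        forall c' : R -> M, geodesic c' -> joins c' x y ->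
          forall t, 0 <= t <= 1 -> c' t = c t].

Definition exp_graph x (v : 'rV[R]_n) y : Prop :=
  exists c, [/\ geodesic c, joins c x y & velocity c 0 = v].

Definition Exp x (v : 'rV[R]_n) : M := xget x [set y | exp_graph x v y].

Definition Log x y : 'rV[R]_n := xget 0 [set v | Exp x v = y].

(* Exp_x is defined on the whole of T_x M and has an inverse M -> T_x M. *)
Definition exp_invertible : Prop :=
  (forall x v, exists y, exp_graph x v y) /\ (forall x, bijective (Exp x)).

Definition proj_dist u v w : R := tnorm u (Log u v - Log u w).

Definition mdifferentiable (f : M -> R) : Prop :=
  forall i p, chart_dom i p ->
    differentiable (f \o chart_inv i : 'rV[R]_n -> R^o) (chart_map i p).

Definition grad (f : M -> R) p : 'rV[R]_n :=
  xget 0 [set w | forall v, inner p w v =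
    'd (f \o chart_inv (chart_at p) : 'rV[R]_n -> R^o)
       (chart_map (chart_at p) p) v].

Definition geod_strongly_convex (mu : R) (f : M -> R) : Prop :=
  forall x y,
    f x + inner x (grad f x) (Log x y) + mu / 2 * rdist x y ^+ 2 <= f y.

Definition geod_smooth (L : R) (f : M -> R) : Prop :=
  forall x y,
    f y <= f x + inner x (grad f x) (Log x y) + L / 2 * rdist x y ^+ 2.

Definition potential (f : M -> R) (xs : M) (A B : R) (x y z : M) : R :=
  A * (f y - f xs) + B * proj_dist x z xs ^+ 2.

End Riemannian.

Arguments sectional_bounded_below {R n} M k.
Arguments uniquely_geodesic {R n} M.
Arguments exp_invertible {R n} M.

(* Main.v *)
Require Import Defs.
From mathcomp Require Import all_boot all_order all_algebra.
From mathcomp Require Import all_classical all_reals all_analysis.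
From mathcomp Require Import ring lra.

Import Order.TTheory GRing.Theory Num.Theory.
Import numFieldNormedType.Exports.
Local Open Scope ring_scope.

(** Everything takes place in the tangent space at the new point x = x_{t+1},
    with its gradient g and the Euclidean structure given by the metric.

    The step z_{t+1} is defined through its logarithm at x, namely
    beta * Log_x z_t - eta * g, so its projected distance to the minimizer
    expands as a Euclidean norm.  The inner products with g that appear are
    cancelled by three inequalities on f: descent along the gradient step to
    y_{t+1}, strong convexity from x to the minimizer, and convexity from x to
    y_t.  The last one concerns Log_x y_t, not Log_x z_t; but x lies on the
    geodesic from y_t to z_t, so the two logarithms are opposite multiples of
    one vector ([Log_balance]).  The quadratic term of strong convexity at the
    minimizer is exactly the weight 1 - beta needed to compare
    |beta Log_x z_t - Log_x x_*|^2 with beta |Log_x z_t - Log_x x_*|^2 by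
    convexity of the squared norm ([accelerated_step]).  The valid distortion rate then replaces the
    distance projected at x by the one projected at x_t, and the equation for
    xi makes the coefficients agree.

    Two facts of Riemannian geometry are needed to turn statements about
    points into statements about tangent vectors.

    First, Exp and Log are inverse to each other and Exp_x v is the endpoint
    of every geodesic issued from x with velocity v ([exp_graphE]).  This
    would usually come from uniqueness for the geodesic differential equation.
    Here it follows from uniqueness of the geodesic joining two points: a
    vector leading from x to y is determined by y, and bijectivity of Exp_x
    then forbids that the same vector lead to two different points.

    Second, rdist x y is the norm of Log x y ([rdist_Log]), because geodesics
    have constant speed ([geodesic_constant_speed]).  The speed is
    differentiated in a chart, where the Christoffel symbols are exactly what
    cancels the derivative of the metric ([christoffel_cancellation]). *)

(** * Differentiating curves in normed spaces *)

Section Curves.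
Variable R : realType.
Local Open Scope classical_set_scope.

Lemma derive1_along (V W : normedModType R) (u : R -> V) (F : V -> W) (t : R) :
  derivable u t 1 -> differentiable F (u t) ->
  derivable (F \o u) t 1 /\ derive1 (F \o u) t = 'd F (u t) (derive1 u t).
Proof.
move=> /derivable1_diffP du dF.
have dFu : differentiable (F \o u) t by exact: differentiable_comp.
split; first exact/derivable1_diffP.
by rewrite !derive1E' // diff_comp.
Qed.

Definition affine (a b s : R) : R := a + b * s.

Lemma continuous_affine (a b : R) : continuous (affine a b).
Proof.
move=> t; apply: (@continuousD _ R^o R^o (fun=> a) (fun s => b * s)).
  exact: cst_continuous.
exact: mulrl_continuous.
Qed.

Lemma derive1_affine (V : normedModType R) (u : R -> V) (a b t : R) :
  derivable u (affine a b t) 1 ->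
  derivable (u \o affine a b) t 1 /\
  derive1 (u \o affine a b) t = b *: derive1 u (affine a b t).
Proof.
move=> du.
have ha : is_derive t (1 : R) (affine a b) b.
  rewrite /affine; apply: is_derive_eq.
  by rewrite add0r mul1r [LHS]mulr1.
have [da dE] := ha.
have [? ->] := derive1_along _ _ (affine a b) u t da ((derivable1_diffP _ _).1 du).
split => //.
by rewrite derive1E dE diff1E //; apply/derivable1_diffP.
Qed.

Lemma near_affine (a b t : R) (P : R -> Prop) :
  (\forall s \near affine a b t, P s) -> \forall s \near t, P (affine a b s).
Proof. exact: continuous_affine. Qed.

Lemma derive1_derive1_affine (V : normedModType R) (u : R -> V) (a b t : R) :
  (\forall s \near affine a b t, derivable u s 1) ->
  derivable (derive1 u) (affine a b t) 1 ->
  derivable (derive1 (u \o affine a b)) t 1 /\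
  derive1 (derive1 (u \o affine a b)) t =
    b *: (b *: derive1 (derive1 u) (affine a b t)).
Proof.
move=> /near_affine du ddu.
have [dda ddE] := derive1_affine _ _ _ _ _ ddu.
pose v := b \*: (derive1 u \o affine a b).
have vE : \forall s \near t, v s = derive1 (u \o affine a b) s.
  by apply: filterS du => s ds; exact: esym (derive1_affine _ _ _ _ _ ds).2.
have dv : derivable v t 1 by exact: derivableZ.
split; first exact: (near_eq_derivable vE dv).
rewrite derive1E -(near_eq_derive _ vE) -ddE [in RHS]derive1E.
exact: deriveZ.
Qed.

(** A two-sided derivative at 0 is the limit of difference quotients from the
    right, which only see [0, 1]. *)
Lemma derive1_eq_on_unit (V : normedModType R) (u v : R -> V) :
  derivable u 0 1 -> derivable v 0 1 ->
  (forall t, 0 <= t <= 1 -> u t = v t) -> derive1 u 0 = derive1 v 0.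
Proof.
move=> du dv uv; rewrite /derive1.
have conv (w : R -> V) : derivable w 0 1 ->
    cvg ((fun h => h^-1 *: (w (h + 0) - w 0)) @ 0^').
  by move=> /cvg_ex [l wl]; apply/cvg_ex; exists l;
    under eq_fun => h do rewrite -[X in w (X + _)]mulr1.
rewrite (cvg_at_rightE (fun h => h^-1 *: (u (h + 0) - u 0)) 0 (conv u du)).
rewrite (cvg_at_rightE (fun h => h^-1 *: (v (h + 0) - v 0)) 0 (conv v dv)).
congr (lim _); rewrite eqEsubset.
suff E : \forall h \near 0^'+,
    h^-1 *: (u (h + 0) - u 0) = h^-1 *: (v (h + 0) - v 0).
  split; apply: near_eq_cvg => //.
  by apply: filterS E => h ->.
near=> h.
have h01 : 0 <= h <= 1.
  by apply/andP; split => //; near: h; exact: nbhs_right_le.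
by rewrite addr0 !uv ?h01 ?lexx ?ler01.
Unshelve. all: by end_near. Qed.

End Curves.

(** * Geodesics, exponential and logarithm *)

Section Geodesics.
Variables (R : realType) (n : nat) (M : riemannianManifold R n).
Implicit Types (c : R -> M) (x y : M) (v : 'rV[R]_n).
Local Open Scope classical_set_scope.

Lemma geodesic_at_derivable c t : geodesic_at c t ->
  derivable (chart_map (chart_at (c t)) \o c) t 1.
Proof. by move=> [_ /(_ _ (chart_at_dom _))[/nbhs_singleton]]. Qed.

Lemma velocity_affine c a b t : geodesic_at c (affine R a b t) ->
  velocity (c \o affine R a b) t = b *: velocity c (affine R a b t).
Proof.
move=> /geodesic_at_derivable dc; rewrite /velocity.
by have [_ <-] := derive1_affine R _ _ _ _ _ dc.
Qed.

(** The geodesic equation is homogeneous of degree two in the velocity, the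
    acceleration scaling by [b * b] as well. *)
Lemma geodesic_at_affine c a b t :
  geodesic_at c (affine R a b t) -> geodesic_at (c \o affine R a b) t.
Proof.
move=> [cc gc]; split.
  by apply: continuous_comp => //; exact: continuous_affine.
move=> i ci; have [du ddu eqn] := gc i ci.
set u := chart_map i \o c in du ddu eqn *.
rewrite -[_ \o (c \o _)]/(u \o affine R a b); clearbody u.
have [ddv ddvE] := derive1_derive1_affine R _ u a b t du ddu.
split; [|exact: ddv|].
- apply: filterS (near_affine R a b t (fun s => derivable u s 1) du) => s ds.
  exact: (derive1_affine R _ _ _ _ _ ds).1.
- have [_ dvE] := derive1_affine R _ u a b t (nbhs_singleton du).
  move=> k; rewrite ddvE dvE -[RHS](mulr0 (b * b)) -[X in _ = _ * X](eqn k) mulrDr.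
  congr (_ + _); first by rewrite !mxE mulrA.
  rewrite mulr_sumr; apply: eq_bigr => p _.
  rewrite mulr_sumr; apply: eq_bigr => q _.
  by rewrite !mxE /=; ring.
Qed.

Lemma geodesic_affine c a b : 0 <= a <= 1 -> 0 <= a + b <= 1 ->
  geodesic c -> geodesic (c \o affine R a b).
Proof.
move=> /andP[a0 a1] /andP[ab0 ab1] [e e0 gc].
(* The slope satisfies |b| <= 1, so the margin around [0, 1] does not grow;
   with half the margin, non-strict estimates suffice. *)
exists (e / 2) => [|t te t1]; first by rewrite divr_gt0.
apply: geodesic_at_affine; apply: gc; rewrite /affine; case: (lerP 0 b) => b0.
- have : 0 <= b * (t + e / 2) by apply: mulr_ge0 => //; lra.
  have : 0 <= e * (1 - b) by apply: mulr_ge0; lra.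
  by lra.
- have : 0 <= - b * (1 + e / 2 - t) by apply: mulr_ge0 => //; lra.
  have : 0 <= e * (1 + b) by apply: mulr_ge0; lra.
  by lra.
- have : 0 <= b * (1 + e / 2 - t) by apply: mulr_ge0 => //; lra.
  have : 0 <= e * (1 - b) by apply: mulr_ge0; lra.
  by lra.
- have : 0 <= - b * (t + e / 2) by apply: mulr_ge0 => //; lra.
  have : 0 <= e * (1 + b) by apply: mulr_ge0; lra.
  by lra.
Qed.

Lemma geodesic_at_unit c t : geodesic c -> 0 <= t <= 1 -> geodesic_at c t.
Proof. by move=> [e e0 gc] /andP[t0 t1]; apply: gc; lra. Qed.

(** The case [b < a] matters: a geodesic may be run backwards from an interior
    point, which is how the logarithm of [y] at a point between [y]
    and [z] is reached. *)
Lemma exp_graph_segment c a b : geodesic c -> 0 <= a <= 1 -> 0 <= b <= 1 ->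
  exp_graph (c a) ((b - a) *: velocity c a) (c b).
Proof.
move=> gc a01 b01; exists (c \o affine R a (b - a)).
have a0 : affine R a (b - a) 0 = a by rewrite /affine mulr0 addr0.
have a1 : affine R a (b - a) 1 = b by rewrite /affine mulr1 addrC subrK.
split; first by apply: geodesic_affine => //; rewrite addrC subrK.
  by split; rewrite /= ?a0 ?a1.
by rewrite velocity_affine a0 //; exact: geodesic_at_unit.
Qed.

Hypotheses (ugeod : uniquely_geodesic M) (expM : exp_invertible M).

(** Two geodesics from x to y agree on the unit interval, hence have the same
    initial velocity. *)
Lemma exp_graph_vector_unique x v v' y :
  exp_graph x v y -> exp_graph x v' y -> v = v'.
Proof.
move=> [c [gc jc <-]] [c' [gc' jc' <-]].
have [c0 [_ _ _ uniq]] := ugeod x y.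
have cc' t : 0 <= t <= 1 -> c t = c' t.
  by move=> t01; rewrite (uniq c) // (uniq c').
have [c0x _] := jc; have [c'0x _] := jc'.
rewrite /velocity c0x c'0x; apply: derive1_eq_on_unit.
- by rewrite -c0x; apply/geodesic_at_derivable/geodesic_at_unit; rewrite ?lexx ?ler01.
- by rewrite -c'0x; apply/geodesic_at_derivable/geodesic_at_unit; rewrite ?lexx ?ler01.
- by move=> t t01 /=; rewrite cc'.
Qed.

Lemma exp_graph_Exp x v : exp_graph x v (Exp x v).
Proof. exact: (xgetPex x (expM.1 x v)). Qed.

Lemma Exp_inj x : injective (Exp x).
Proof. by have [g gK _] := expM.2 x; exact: can_inj gK. Qed.

(** Write y as [Exp x w].  The vectors v and w both lead from x to y, so they
    are equal: this replaces uniqueness for the geodesic equation. *)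
Lemma exp_graphE x v y : exp_graph x v y -> Exp x v = y.
Proof.
move=> xvy; have [g _ gK] := expM.2 x.
rewrite -[RHS]gK; congr (Exp x _).
apply: (exp_graph_vector_unique x _ _ y) => //.
by rewrite -[X in exp_graph _ _ X]gK; exact: exp_graph_Exp.
Qed.

Lemma ExpK x v : Log x (Exp x v) = v.
Proof.
apply: (Exp_inj x).
exact: (xgetPex 0 (P := [set w | Exp x w = Exp x v]) (ex_intro _ v erefl)).
Qed.

Lemma LogK x y : Exp x (Log x y) = y.
Proof. by have [g _ gK] := expM.2 x; rewrite -(gK y) ExpK. Qed.

Lemma Log_geodesic c a b : geodesic c -> 0 <= a <= 1 -> 0 <= b <= 1 ->
  Log (c a) (c b) = (b - a) *: velocity c a.
Proof.
by move=> gc a01 b01; rewrite -(exp_graphE _ _ _ (exp_graph_segment c a b gc a01 b01)) ExpK.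
Qed.

(** If w is the velocity of the geodesic from y to z at its time [a], then
    [Log x y = - a *: w] and [Log x z = (1 - a) *: w]. *)
Lemma Log_balance y z (a : R) : 0 <= a <= 1 ->
  let x := Exp y (a *: Log y z) in
  (1 - a) *: Log x y + a *: Log x z = 0.
Proof.
move=> a01 x.
have [c [gc [c0 c1] vc]] := exp_graph_Exp y (Log y z).
have o0 : 0 <= (0 : R) <= 1 by rewrite lexx ler01.
have o1 : 0 <= (1 : R) <= 1 by rewrite lexx ler01.
have xE : c a = x.
  rewrite /x -{1}c0 -vc -{2}[a]subr0; apply/esym/exp_graphE; exact: exp_graph_segment.
rewrite -xE -{1}c0 -(LogK y z) -c1 !Log_geodesic // !scalerA -scalerDl.
by rewrite (_ : (1 - a) * (0 - a) + a * (1 - a) = 0) ?scale0r //; ring.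
Qed.

End Geodesics.

(** * The energy of a geodesic in coordinates *)

Section EnergyCoordinates.
Variables (R : realType) (n : nat).
Local Open Scope classical_set_scope.

Lemma bilinE (G : 'M[R]_n) (v w : 'rV[R]_n) :
  bilin G v w = \sum_(a < n) \sum_(b < n) v 0 a * G a b * w 0 b.
Proof.
rewrite /bilin mxE exchange_big; apply: eq_bigr => b _.
by rewrite !mxE mulr_suml.
Qed.

(** Pointwise form of the conservation of energy: [p] and [q] stand for the
    velocity and the acceleration, [dG l] for the l-th partial derivative of
    the Gram matrix.  Contracting the inverse matrix with [G] lowers the index
    of the Christoffel symbols; in the contraction with p three times, two of
    the three derivative terms cancel by symmetry, and half of the remaining
    cubic form is subtracted twice, once per slot of the bilinear form. *)
Lemma christoffel_cancellation (G : 'M[R]_n) (dG : 'I_n -> 'I_n -> 'I_n -> R)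
    (p q : 'rV[R]_n) :
  G^T = G -> G \in unitmx ->
  (forall k, q 0 k + \sum_(a < n) \sum_(b < n)
     (2^-1 * \sum_(l < n) invmx G k l * (dG a l b + dG b l a - dG l a b))
       * p 0 a * p 0 b = 0) ->
  2 * bilin G p q + \sum_(a < n) \sum_(b < n)
     p 0 a * (\sum_(l < n) p 0 l * dG l a b) * p 0 b = 0.
Proof.
move=> Gsym Gunit eqn.
(* Twice the Christoffel symbols of the first kind, contracted with p. *)
pose lower l := \sum_(a < n) \sum_(b < n)
  (dG a l b + dG b l a - dG l a b) * p 0 a * p 0 b.
have qE k : q 0 k = - (2^-1 * \sum_(l < n) invmx G k l * lower l).
  apply/eqP; rewrite -addr_eq0 -[X in _ == X](eqn k); apply/eqP; congr (_ + _).
  rewrite mulr_sumr.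
  under eq_bigr do rewrite /lower !mulr_sumr.
  rewrite exchange_big; apply: eq_bigr => a _ /=.
  under eq_bigr do rewrite !mulr_sumr.
  rewrite exchange_big; apply: eq_bigr => b _ /=.
  rewrite -!mulrA [RHS]mulrC mulr_suml mulr_suml; apply: eq_bigr => l _; ring.
pose S := \sum_(l < n) \sum_(a < n) \sum_(b < n) dG l a b * p 0 l * p 0 a * p 0 b.
have S1 : \sum_(l < n) \sum_(a < n) \sum_(b < n)
    dG a l b * p 0 l * p 0 a * p 0 b = S.
  rewrite exchange_big; do 3![apply: eq_bigr => ? _ /=]; ring.
have S2 : \sum_(l < n) \sum_(a < n) \sum_(b < n)
    dG b l a * p 0 l * p 0 a * p 0 b = S.
  rewrite -S1; apply: eq_bigr => l _.
  rewrite exchange_big; do 2![apply: eq_bigr => ? _ /=]; ring.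
have lowerS : \sum_(l < n) p 0 l * lower l = S.
  rewrite -[RHS](addrK S) -{1}S1 -{1}S2 /S.
  rewrite -big_split -sumrB; apply: eq_bigr => l _ /=.
  rewrite -big_split -sumrB /lower mulr_sumr; apply: eq_bigr => a _ /=.
  rewrite -big_split -sumrB mulr_sumr; apply: eq_bigr => b _ /=; ring.
have pq : 2 * bilin G p q = - S.
  rewrite -lowerS /bilin.
  have -> : q^T = - (2^-1 *: (invmx G *m \col_l lower l)).
    apply/matrixP => k z; rewrite !mxE (_ : z = 0) ?ord1 // qE.
    by congr (- (_ * _)); apply: eq_bigr => l _; rewrite mxE.
  rewrite mulmxN -scalemxAr mulmxA mulmxK // !mxE mulrN mulrA divff ?pnatr_eq0 // mul1r.
  by congr (- _); apply: eq_bigr => l _; rewrite mxE.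
rewrite pq /S; apply/eqP; rewrite addrC subr_eq0; apply/eqP.
rewrite [RHS]exchange_big; apply: eq_bigr => a _ /=.
rewrite [RHS]exchange_big; apply: eq_bigr => b _ /=.
rewrite mulr_sumr mulr_suml; apply: eq_bigr => l _; ring.
Qed.

Lemma diff_coord (F : 'rV[R]_n -> R) (u w : 'rV[R]_n) :
  differentiable (F : _ -> R^o) u ->
  'd (F : _ -> R^o) u w = \sum_(l < n) w 0 l * pderiv l F u.
Proof.
move=> dF; rewrite {1}(row_sum_delta w) linear_sum; apply: eq_bigr => l _.
by rewrite linearZ /pderiv deriveE.
Qed.

Lemma is_derive_coord (w : R -> 'rV[R]_n) (t : R) (a : 'I_n) :
  derivable w t 1 -> is_derive t 1 (fun s => w s 0 a) (derive1 w t 0 a).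
Proof.
move=> dw; have /derivable_mxP dwa := dw.
apply: DeriveDef; first exact: dwa.
by rewrite derive1E derive_mx // mxE.
Qed.

Lemma is_derive_mul3 (f g h : R -> R) (t df dg dh : R) :
  is_derive t 1 f df -> is_derive t 1 g dg -> is_derive t 1 h dh ->
  is_derive t 1 (fun s => f s * g s * h s)
    (df * g t * h t + f t * dg * h t + f t * g t * dh).
Proof.
move=> Df Dg Dh; apply: (is_derive_eq (is_deriveM (is_deriveM Df Dg) Dh)).
rewrite -[(f * g) t]/(f t * g t) /GRing.scale /=; ring.
Qed.

Lemma is_derive_sum_pointwise (m : nat) (h : 'I_m -> R -> R) (dh : 'I_m -> R)
    (t : R) :
  (forall i, is_derive t 1 (h i) (dh i)) ->
  is_derive t 1 (fun s => \sum_(i < m) h i s) (\sum_(i < m) dh i).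
Proof. by move=> Dh; rewrite -fct_sumE; exact: is_derive_sum. Qed.

(** [G] is only assumed symmetric and invertible at the point where the
    derivative is taken, so that a chart can be chosen in which the Gram
    matrix at that point is the given metric itself. *)
Lemma is_derive_energy (G : 'rV[R]_n -> 'M[R]_n) (u : R -> 'rV[R]_n) (t : R) :
  (forall a b, differentiable (fun w => G w a b : R^o) (u t)) ->
  derivable u t 1 -> derivable (derive1 u) t 1 ->
  (G (u t))^T = G (u t) -> G (u t) \in unitmx ->
  (forall k, derive1 (derive1 u) t 0 k + \sum_(a < n) \sum_(b < n)
     (2^-1 * \sum_(l < n) invmx (G (u t)) k l *
       (pderiv a (fun w => G w l b) (u t) + pderiv b (fun w => G w l a) (u t)
        - pderiv l (fun w => G w a b) (u t)))
       * derive1 u t 0 a * derive1 u t 0 b = 0) ->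
  is_derive t 1 (fun s => bilin (G (u s)) (derive1 u s) (derive1 u s)) (0 : R).
Proof.
move=> dG du ddu Gsym Gunit eqn.
under eq_fun do rewrite bilinE.
set p := derive1 u t; set q := derive1 (derive1 u) t.
have dterm a b : is_derive t 1
    (fun s => derive1 u s 0 a * G (u s) a b * derive1 u s 0 b)
    (q 0 a * G (u t) a b * p 0 b
     + p 0 a * (\sum_(l < n) p 0 l * pderiv l (fun w => G w a b) (u t)) * p 0 b
     + p 0 a * G (u t) a b * q 0 b).
  apply: is_derive_mul3; [exact: is_derive_coord| |exact: is_derive_coord].
  have [dgu dguE] := derive1_along R _ _ u (fun w => G w a b : R^o) t du (dG a b).
  by apply: DeriveDef => //; rewrite -derive1E dguE diff_coord.
have denergy := is_derive_sum_pointwise _ _ _ t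
  (fun a => is_derive_sum_pointwise _ _ _ t (dterm a)).
apply: (is_derive_eq denergy).
have bilin_sym : bilin (G (u t)) q p = bilin (G (u t)) p q.
  rewrite !bilinE exchange_big; do 2![apply: eq_bigr => ? _ /=].
  rewrite -{1}Gsym mxE; ring.
rewrite -[RHS](christoffel_cancellation (G (u t)) _ p q Gsym Gunit eqn).
rewrite [2 * _]mulr_natl mulr2n -{2}bilin_sym !bilinE /=.
under [LHS]eq_bigr => a _ do rewrite !big_split /=.
by rewrite !big_split /= addrAC [X in X + _]addrC.
Qed.

End EnergyCoordinates.

(** * Geodesics have constant speed *)

Section ConstantSpeed.
Variables (R : realType) (n : nat) (M : riemannianManifold R n).
Implicit Types (c : R -> M) (p x y : M) (v : 'rV[R]_n) (i j : chart_index M).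
Local Open Scope classical_set_scope.

Lemma near_chart_dom c i t : {for t, continuous c} -> chart_dom i (c t) ->
  \forall s \near t, chart_dom i (c s).
Proof.
move=> cc ci; apply: (cc (chart_dom i)).
by apply: open_nbhs_nbhs; split => //; exact: chart_dom_open.
Qed.

Lemma differentiable_transition i j p : chart_dom i p -> chart_dom j p ->
  differentiable (chart_map j \o chart_inv i) (chart_map i p).
Proof.
move=> ip jp; have [+ _] := transition_smooth i j 1; apply.
by exists p.
Qed.

(** The change of coordinates from the preferred chart to itself is the
    identity near the point, so its Jacobian is the identity matrix. *)
Lemma gram_center p :
  gram (@metric _ _ M) (chart_at p) (chart_map (chart_at p) p) = metric p.
Proof.
set i := chart_at p; set u := chart_map i p.
have ip : chart_dom i p by exact: chart_at_dom.
rewrite /gram (chart_mapK ip) -/i.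
suff -> : jacobian (chart_map i \o chart_inv i) u = 1%:M.
  by rewrite trmx1 mulmx1 mul1mx.
apply/row_matrixP => k; rewrite !rowE -deriveEjacobian; last first.
  exact: differentiable_transition.
rewrite mulmx1 -[RHS](derive_id u); apply: near_eq_derive.
have : nbhs u (chart_map i @` chart_dom i).
  by apply: open_nbhs_nbhs; split; [exact: chart_image_open|exists p].
by apply: filterS => _ [q iq <-]; rewrite /= (chart_mapK iq).
Qed.

(** The velocity at [c t] lives in the preferred chart of [c t], which may jump
    with t.  Its squared norm can still be computed in the fixed chart [i]: by
    the chain rule, the Jacobian in the Gram matrix carries the derivative in
    chart [i] to the velocity. *)
Lemma bilin_gram i c t : {for t, continuous c} -> chart_dom i (c t) ->
  derivable (chart_map i \o c) t 1 ->
  let du := derive1 (chart_map i \o c) t in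
  bilin (gram (@metric _ _ M) i (chart_map i (c t))) du du =
  inner (c t) (velocity c t) (velocity c t).
Proof.
move=> cc ci dc du; rewrite /gram (chart_mapK ci).
set j := chart_at (c t); set T := chart_map j \o chart_inv i.
have dT : differentiable T (chart_map i (c t)).
  by apply: differentiable_transition => //; exact: chart_at_dom.
have velE : velocity c t = du *m jacobian T (chart_map i (c t)).
  rewrite -(deriveEjacobian _ dT) (deriveE _ dT).
  rewrite -[RHS](derive1_along R _ _ _ T t dc dT).2 /velocity !derive1E.
  apply: near_eq_derive.
  by apply: filterS (near_chart_dom c i t cc ci) => s is_; rewrite /T /= (chart_mapK is_).
by rewrite velE /inner /bilin trmx_mul !mulmxA.
Qed.

Lemma metric_unit p : metric p \in unitmx.
Proof.
rewrite -row_free_unit -kermx_eq0; apply/eqP/row_matrixP => k.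
rewrite row0; apply/eqP/negPn/negP => /(@metric_pos _ _ M p _).
by rewrite /bilin -row_mul mulmx_ker row0 mul0mx mxE ltxx.
Qed.

(** The computation is made in the preferred chart of [c t], kept fixed while
    the time varies around t. *)
Lemma is_derive_speed2 c t : (\forall s \near t, geodesic_at c s) ->
  is_derive t 1 (fun s => inner (c s) (velocity c s) (velocity c s)) (0 : R).
Proof.
move=> gc; have [ct /(_ _ (chart_at_dom (c t)))] := nbhs_singleton gc.
set i := chart_at (c t) => -[du ddu eqn].
have ci : chart_dom i (c t) by exact: chart_at_dom.
pose G := gram (@metric _ _ M) i.
have GE : G ((chart_map i \o c) t) = metric (c t) by exact: gram_center.
apply: (@near_eq_is_derive _ _ _ (fun s => bilin (G ((chart_map i \o c) s))
    (derive1 (chart_map i \o c) s) (derive1 (chart_map i \o c) s))).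
  apply: filterS2 (near_chart_dom c i t ct ci) gc => s is_ [cs gs].
  have [dus _ _] := gs i is_.
  exact: (bilin_gram i c s cs is_ (nbhs_singleton dus)).
have dG a b : differentiable (fun w => G w a b : R^o) ((chart_map i \o c) t).
  by have [dg _] := @metric_smooth _ _ M i a b 1; apply: dg; exists (c t).
apply: (is_derive_energy R n G _ t dG (nbhs_singleton du) ddu).
- by rewrite GE Defs.metric_sym.
- by rewrite GE metric_unit.
- exact: eqn.
Qed.

Lemma geodesic_constant_speed c (t : R) : geodesic c -> 0 <= t <= 1 ->
  tnorm (c t) (velocity c t) = tnorm (c 0) (velocity c 0).
Proof.
move=> [e e0 gc] /andP[t0 t1].
pose h s := inner (c s) (velocity c s) (velocity c s).
suff hE : h t = h 0 by rewrite /tnorm -/(h t) -/(h 0) hE.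
have dh (s : R) : 0 <= s <= 1 -> is_derive s 1 h (0 : R).
  move=> /andP[s0 s1]; apply: is_derive_speed2.
  near=> r; apply: gc; near: r; [apply: lt_nbhsr|apply: lt_nbhsl]; lra.
have [||_ _] := @MVT_segment R h (fun=> 0) 0 t t0; last first.
- by move=> /eqP; rewrite mul0r subr_eq0 => /eqP.
- apply: derivable_within_continuous => s; rewrite in_itv /= => /andP[s0 st].
  by apply: ex_derive; apply: dh; rewrite s0 (le_trans st).
- move=> s; rewrite in_itv /= => /andP[s0 st].
  by apply: dh; rewrite (ltW s0) (le_trans (ltW st)).
Unshelve. all: by end_near. Qed.

Lemma geodesic_length c : geodesic c ->
  curve_length c = tnorm (c 0) (velocity c 0).
Proof.
move=> gc; rewrite /curve_length.
rewrite (@eq_Rintegral _ _ _ _ _ (fun=> tnorm (c 0) (velocity c 0))); last first.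
  by move=> t; rewrite inE /= in_itv /= => t01; exact: geodesic_constant_speed.
rewrite Rintegral_cst //= lebesgue_measure_itv /= lte_fin ltr01.
by rewrite -EFinD /= subr0 mulr1.
Qed.

(** The minimizing geodesic is parametrized on the unit interval at constant
    speed, so its length is the norm of its initial velocity. *)
Lemma rdist_Log (ugeod : uniquely_geodesic M) (expM : exp_invertible M) x y :
  rdist x y = tnorm x (Log x y).
Proof.
have [c [gc [c0 c1] <- _]] := ugeod x y.
rewrite geodesic_length // -c0 -c1 Log_geodesic ?lexx ?ler01 //.
by rewrite subr0 scale1r.
Qed.

End ConstantSpeed.

(** * One step of the method, in a single tangent space *)

Section TangentInnerProduct.
Variables (R : realType) (n : nat) (M : riemannianManifold R n) (x : M).
Implicit Types (v w z : 'rV[R]_n) (a : R).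

Lemma innerC v w : inner x v w = inner x w v.
Proof.
rewrite /inner !bilinE exchange_big; do 2![apply: eq_bigr => ? _ /=].
rewrite -{1}(Defs.metric_sym x) mxE; ring.
Qed.

Lemma innerDl v w z : inner x (v + w) z = inner x v z + inner x w z.
Proof. by rewrite /inner /bilin !mulmxDl mxE. Qed.

Lemma innerZl a v w : inner x (a *: v) w = a * inner x v w.
Proof. by rewrite /inner /bilin -!scalemxAl mxE. Qed.

Lemma innerNl v w : inner x (- v) w = - inner x v w.
Proof. by rewrite -[- v]scaleN1r innerZl mulN1r. Qed.

Lemma innerDr v w z : inner x z (v + w) = inner x z v + inner x z w.
Proof. by rewrite innerC innerDl !(innerC z). Qed.

Lemma innerZr a v w : inner x w (a *: v) = a * inner x w v.
Proof. by rewrite innerC innerZl innerC. Qed.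

Lemma innerNr v w : inner x w (- v) = - inner x w v.
Proof. by rewrite innerC innerNl innerC. Qed.

Lemma inner_ge0 v : 0 <= inner x v v.
Proof.
have [->|v0] := eqVneq v 0; first by have := innerZl 0 0 0; rewrite scale0r mul0r => ->.
exact/ltW/metric_pos.
Qed.

Lemma tnorm_sqr v : tnorm x v ^+ 2 = inner x v v.
Proof. by rewrite sqr_sqrtr ?inner_ge0. Qed.

End TangentInnerProduct.

(** Here [z] and [u] stand for the logarithms at x of z_t and of the minimizer.
    Put m = 2 mu D.  The descent inequality is added to [xi] times the
    inequality at the minimizer and to the inequality at y_t, whose last term
    is already weighted by [1 - xi].  This leaves
    - D <g, g> + (xi - m) <g, z> - xi <g, u>.  With beta = 1 - m / xi and
    eta = 2 D / xi, the expansion of xi^2 / (4 D) times the square contributes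
    exactly the opposite of these three terms. *)
Lemma accelerated_step (R : realType) (n : nat) (M : riemannianManifold R n)
    (x : M) (g z u : 'rV[R]_n) (mu D xi fx fy fy1 fs : R) :
  0 < D -> 0 <= mu -> 0 < xi -> 2 * mu * D <= xi -> xi < 1 ->
  fy1 <= fx - D * inner x g g ->
  fx + inner x g u + mu / 2 * inner x u u <= fs ->
  (1 - xi) * fx - (xi - 2 * mu * D) * inner x g z <= (1 - xi) * fy ->
  fy1 - fs + xi ^+ 2 / (4 * D) *
      tnorm x ((1 - 2 * mu * D * xi^-1) *: z - (2 * D * xi^-1) *: g - u) ^+ 2
  <= (1 - xi) * (fy - fs)
     + xi * (xi - 2 * mu * D) / (4 * D) * tnorm x (z - u) ^+ 2.
Proof.
move=> D0 mu0 xi0 mxi xi1 descent at_minimizer at_iterate.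
rewrite !tnorm_sqr !(innerDl, innerDr, innerNl, innerNr, innerZl, innerZr).
rewrite (innerC _ _ M x z g) (innerC _ _ M x u g) (innerC _ _ M x u z).
have zz := inner_ge0 _ _ M x z.
move: (inner x g g) (inner x g u) (inner x g z) (inner x u u) (inner x z u)
  (inner x z z) descent at_minimizer at_iterate zz.
move=> gg gu gz uu zu zz descent at_minimizer at_iterate zz0.
have D_neq0 : D != 0 by rewrite gt_eqF.
have xi_neq0 : xi != 0 by rewrite gt_eqF.
(* This is xi^2 / (4 D) * beta (1 - beta) |z|^2, the gap in the convexity of
   the squared norm for beta *: z - u = beta *: (z - u) + (1 - beta) *: (- u). *)
have slack : 0 <= mu / 2 * (xi - 2 * mu * D) * zz.
  by rewrite !mulr_ge0 ?divr_ge0 ?subr_ge0.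
have weighted : xi * (fx + gu + mu / 2 * uu) <= xi * fs by rewrite ler_pM2l.
rewrite -subr_ge0.
set rhs := (X in 0 <= X).
have -> : rhs = mu / 2 * (xi - 2 * mu * D) * zz
    + (fx - D * gg - fy1) + (xi * fs - xi * (fx + gu + mu / 2 * uu))
    + ((1 - xi) * fy - ((1 - xi) * fx - (xi - 2 * mu * D) * gz)).
  by rewrite /rhs; field; rewrite xi_neq0.
lra.
Qed.

Theorem theorem3p1 (R : realType) (n : nat) (M : riemannianManifold R n)
  (kappa : R) (kappa_ge0 : 0 <= kappa)
  (curv : sectional_bounded_below M (- kappa))
  (ugeod : uniquely_geodesic M) (expM : exp_invertible M)
  (f : M -> R) (L mu : R) (L_gt0 : 0 < L) (mu_ge0 : 0 <= mu) (mu_leL : mu <= L)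
  (f_diff : mdifferentiable f) (f_smooth : geod_smooth L f)
  (f_convex : geod_strongly_convex mu f)
  (xs : M) (xs_min : forall y : M, f xs <= f y)
  (gamma Dg : R) (gamma_gt0 : 0 < gamma) (gamma_lt : gamma < 2 / L)
  (Dg_def : Dg = gamma * (1 - L * gamma / 2))
  (xt yt zt : M) (At Bt delta : R)
  (At_gt0 : 0 < At) (Bt_gt0 : 0 < Bt) (delta_gt0 : 0 < delta)
  (xi : R) (xi_ge : 2 * mu * Dg <= xi) (xi_lt1 : xi < 1)
  (xi_eq : xi * (xi - 2 * mu * Dg) / (1 - xi) = 4 * Dg / delta * (Bt / At))
  (A1 B1 alpha beta eta : R)
  (A1_def : A1 = At / (1 - xi))
  (B1_def : B1 = xi ^+ 2 / (1 - xi) * (At / (4 * Dg)))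
  (alpha_def : alpha = (xi - 2 * mu * Dg) / (1 - 2 * mu * Dg))
  (beta_def : beta = 1 - 2 * mu * Dg * xi^-1)
  (eta_def : eta = 2 * Dg * xi^-1)
  (x1 y1 z1 : M)
  (x1_def : x1 = Exp yt (alpha *: Log yt zt))
  (y1_def : y1 = Exp x1 (- gamma *: grad f x1))
  (z1_def : z1 = Exp x1 (beta *: Log x1 zt - eta *: grad f x1))
  (distortion : proj_dist x1 zt xs ^+ 2 <= delta * proj_dist xt zt xs ^+ 2) :
  potential f xs A1 B1 x1 y1 z1 <= potential f xs At Bt xt yt zt
  /\ f y1 - f xs + xi ^+ 2 / (4 * Dg) * proj_dist x1 z1 xs ^+ 2
     <= (1 - xi) * (f yt - f xs + Bt / At * proj_dist xt zt xs ^+ 2).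
Proof.
have one_sub_xi_gt0 : 0 < 1 - xi by rewrite subr_gt0.
have Dg_gt0 : 0 < Dg.
  rewrite Dg_def mulr_gt0 // subr_gt0 ltr_pdivrMr // mul1r.
  by rewrite mulrC -ltr_pdivlMr.
have m_ge0 : 0 <= 2 * mu * Dg by rewrite !mulr_ge0 // ltW.
have xi_gt0 : 0 < xi.
  rewrite lt_neqAle (le_trans m_ge0 xi_ge) andbT; apply/eqP => xi0.
  have : 0 < 4 * Dg / delta * (Bt / At) by rewrite mulr_gt0 ?divr_gt0 ?mulr_gt0 ?ltr0n.
  by rewrite -xi_eq -xi0 !mul0r ltxx.
have m_lt1 : 0 < 1 - 2 * mu * Dg by lra.
have alpha01 : 0 <= alpha <= 1.
  rewrite alpha_def divr_ge0 ?subr_ge0 ?(ltW m_lt1) //=; last by lra.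
  by rewrite ler_pdivrMr // mul1r; lra.
have x1_on_segment : (1 - alpha) *: Log x1 yt + alpha *: Log x1 zt = 0.
  by rewrite x1_def; exact: Log_balance.
set g := grad f x1 in y1_def z1_def *.
have descent : f y1 <= f x1 - Dg * inner x1 g g.
  have := f_smooth x1 y1; rewrite rdist_Log // tnorm_sqr -/g.
  rewrite y1_def ExpK // !(innerZl, innerZr) -y1_def => /le_trans; apply.
  by rewrite Dg_def le_eqVlt; apply/orP; left; apply/eqP; field.
have at_minimizer : f x1 + inner x1 g (Log x1 xs)
    + mu / 2 * inner x1 (Log x1 xs) (Log x1 xs) <= f xs.
  by have := f_convex x1 xs; rewrite rdist_Log // tnorm_sqr.
(* Since alpha / (1 - alpha) = (xi - 2 mu Dg) / (1 - xi), the weight 1 - xi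
   turns the gradient term at y_t into one along Log_x z_t. *)
have at_iterate : (1 - xi) * f x1 - (xi - 2 * mu * Dg) * inner x1 g (Log x1 zt)
    <= (1 - xi) * f yt.
  have balance : (1 - xi) * inner x1 g (Log x1 yt)
      = - ((xi - 2 * mu * Dg) * inner x1 g (Log x1 zt)).
    have /(congr1 (fun v => (1 - 2 * mu * Dg) * inner x1 g v)) := x1_on_segment.
    rewrite innerDr !innerZr -[in RHS](scale0r 0) innerZr mul0r mulr0 alpha_def.
    move=> E; apply/eqP; rewrite -addr_eq0 -[X in _ == X]E; apply/eqP.
    by field; rewrite gt_eqF.
  rewrite -balance -mulrDr ler_pM2l //.
  apply: le_trans (f_convex x1 yt); rewrite lerDl.
  by rewrite mulr_ge0 ?divr_ge0 ?sqr_ge0.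
have z1_log : Log x1 z1 =
    (1 - 2 * mu * Dg * xi^-1) *: Log x1 zt - (2 * Dg * xi^-1) *: g.
  by rewrite z1_def ExpK // beta_def eta_def.
have step := accelerated_step _ _ M x1 g (Log x1 zt) (Log x1 xs) mu Dg xi
  (f x1) (f yt) (f y1) (f xs) Dg_gt0 mu_ge0 xi_gt0 xi_ge xi_lt1
  descent at_minimizer at_iterate.
rewrite -z1_log -/(proj_dist x1 z1 xs) -/(proj_dist x1 zt xs) in step.
(* The equation satisfied by xi, in the form in which the distortion rate
   uses it. *)
have coef : xi * (xi - 2 * mu * Dg) / (4 * Dg) * delta = (1 - xi) * (Bt / At).
  have -> : xi * (xi - 2 * mu * Dg) = 4 * Dg / delta * (Bt / At) * (1 - xi).
    by rewrite -xi_eq divfK // gt_eqF.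
  by field; rewrite !gt_eqF.
have contraction : f y1 - f xs + xi ^+ 2 / (4 * Dg) * proj_dist x1 z1 xs ^+ 2
    <= (1 - xi) * (f yt - f xs + Bt / At * proj_dist xt zt xs ^+ 2).
  apply: le_trans step _; rewrite [leRHS]mulrDr lerD2l [leRHS]mulrA -coef -[leRHS]mulrA.
  apply: ler_wpM2l distortion.
  by rewrite divr_ge0 ?mulr_ge0 ?subr_ge0 // ltW.
split=> //.
(* The inequality between potentials is the contraction multiplied by
   At / (1 - xi). *)
rewrite /potential A1_def B1_def.
have -> : At * (f yt - f xs) + Bt * proj_dist xt zt xs ^+ 2 =
    At / (1 - xi) * ((1 - xi) * (f yt - f xs + Bt / At * proj_dist xt zt xs ^+ 2)).
  by field; rewrite !gt_eqF.
apply: le_trans (ler_wpM2l _ contraction); last by rewrite divr_ge0 ?ltW.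
rewrite le_eqVlt; apply/orP; left; apply/eqP.
by field; rewrite !gt_eqF.
Qed.
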